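(* Let $\mathbf k$ be a field of characteristic $c$ and $n,N$ positive integers, and write $N=an+r$ with $0\le r\le n$. If $a\in T_c$, then the $R_{\mathbf k,n}$-module $Q_{\mathbf k,n,N}$ has finite projective dimension.
   Context: $R_{\mathbf k,n}=\mathbf k[x,y,z]/(x^n+y^n+z^n)$ and $Q_{\mathbf k,n,N}=R_{\mathbf k,n}/(x^N,y^N,z^N)$. Sets $T_c$: $T_0=\emptyset$; $T_2$ is the set of all positive integers; for an odd prime $p$, a non-negative integer $a$ lies in $T_p$ iff there exist an odd integer $J$ and $q=p^e$ with $e\ge1$ such that $Jq-\{\frac q3\}\le a<Jq+\{\frac q3\}$, where for an integer $b$, $\{\frac b3\}$ denotes the integer nearest to $b/3$. *)

(* Defs.v *)
From HB Require Import structures.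
From mathcomp Require Import all_boot all_order all_algebra.
From mathcomp Require Import ring_quotient generic_quotient.
From mathcomp Require Import mpoly.
From Stdlib Require Import ClassicalEpsilon.

Set Implicit Arguments.
Unset Strict Implicit.
Unset Printing Implicit Defensive.

Import Order.TTheory GRing.Theory Num.Theory.
Local Open Scope ring_scope.
Local Open Scope quotient_scope.

Definition pbool (P : Prop) : bool :=
  if excluded_middle_informative P then true else false.

Lemma pboolP (P : Prop) : reflect P (pbool P).
Proof. by rewrite /pbool; case: excluded_middle_informative => h; constructor. Qed.

Definition gen_ideal (R : comNzRingType) (s : seq R) : pred R :=
  fun p => pbool (exists c : 'I_(size s) -> R, p = \sum_(i < size s) c i * s`_i).

Lemma gen_ideal_closed (R : comNzRingType) (s : seq R) :
  1 \notin gen_ideal s -> idealr_closed (gen_ideal s).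
Proof.
move=> h1; split=> //.
  apply/pboolP; exists (fun _ => 0); rewrite big1 // => i _; exact: mul0r.
move=> a u v /pboolP [cu ->] /pboolP [cv ->]; apply/pboolP.
exists (fun i => a * cu i + cv i).
rewrite mulr_sumr -big_split /=; apply: eq_bigr => i _.
by rewrite mulrDl mulrA.
Qed.

Definition Sk (k : fieldType) := {mpoly k[3]}.
Definition vx (k : fieldType) : Sk k := 'X_(0 : 'I_3).
Definition vy (k : fieldType) : Sk k := 'X_(1 : 'I_3).
Definition vz (k : fieldType) : Sk k := 'X_(2 : 'I_3).

Definition fermat (k : fieldType) (n : nat) : Sk k :=
  vx k ^+ n + vy k ^+ n + vz k ^+ n.

(* the ideal (x^n + y^n + z^n) of k[x,y,z]; defined for n > 0, where it is proper *)
Definition Rideal (k : fieldType) (n : nat) (hn : (0 < n)%N) : pred (Sk k) :=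
  gen_ideal [:: fermat k n].
Arguments Rideal : clear implicits.

Definition ev0 (k : fieldType) (p : Sk k) : k := p.@[fun _ => 0].

Lemma ev0_var (k : fieldType) (i : 'I_3) m : (0 < m)%N -> ev0 ('X_i ^+ m : Sk k) = 0.
Proof. by move=> hm; rewrite /ev0 rmorphXn /= mevalXU expr0n gtn_eqF. Qed.

Lemma Rideal_proper (k : fieldType) (n : nat) (hn : (0 < n)%N) : 1 \notin Rideal k n hn.
Proof.
apply/pboolP => -[c /(congr1 (@ev0 k))].
rewrite big_ord1 /ev0 meval1 mevalM /fermat !mevalD.
rewrite -!/(ev0 _) /vx /vy /vz !ev0_var // !addr0 mulr0.
exact/eqP/oner_neq0.
Qed.

HB.instance Definition _ k n hn :=
  isIdealr.Build (Sk k) (Rideal k n hn) (gen_ideal_closed (@Rideal_proper k n hn)).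

Definition Rkn (k : fieldType) (n : nat) (hn : (0 < n)%N) :=
  {ideal_quot (Idealr.clone _ (Rideal k n hn) _)}.
Arguments Rkn : clear implicits.

Definition piR (k : fieldType) (n : nat) (hn : (0 < n)%N) : Sk k -> Rkn k n hn :=
  \pi_(Rkn k n hn).
Arguments piR : clear implicits.

(* the ideal (x^N, y^N, z^N) of R_{k,n}; defined for N > 0, where it is proper *)
Definition Jideal (k : fieldType) (n N : nat) (hn : (0 < n)%N) (hN : (0 < N)%N)
  : pred (Rkn k n hn) :=
  gen_ideal [:: piR k n hn (vx k ^+ N); piR k n hn (vy k ^+ N); piR k n hn (vz k ^+ N)].
Arguments Jideal : clear implicits.

Lemma Jideal_proper (k : fieldType) (n N : nat) (hn : (0 < n)%N) (hN : (0 < N)%N) :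
  1 \notin Jideal k n N hn hN.
Proof.
apply/pboolP => -[c].
rewrite !big_ord_recl big_ord0 /= /piR.
rewrite -[c _]reprK -[c (lift _ _)]reprK -[c (lift _ (lift _ _))]reprK.
rewrite -!rmorphM addr0 -!rmorphD -(rmorph1 \pi_(Rkn k n hn)) => /eqP.
rewrite piE Quotient.equivE => /pboolP [d] /(congr1 (@ev0 k)).
rewrite big_ord1 /ev0 /= !(rmorphB, rmorphD, rmorphM, rmorph1) /fermat.
rewrite /vx /vy /vz !(rmorphD, rmorphXn) /= !mevalXU !expr0n !gtn_eqF //.
rewrite !mulr0 !addr0 subr0 mulr0 => /eqP; rewrite oner_eq0.
done.
Qed.

HB.instance Definition _ (k : fieldType) (n N : nat) (hn : (0 < n)%N) (hN : (0 < N)%N) :=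
  isIdealr.Build (Rkn k n hn) (Jideal k n N hn hN)
    (gen_ideal_closed (@Jideal_proper k n N hn hN)).

Definition Qkn (k : fieldType) (n N : nat) (hn : (0 < n)%N) (hN : (0 < N)%N) :=
  {ideal_quot (Idealr.clone _ (Jideal k n N hn hN) _)}.
Arguments Qkn : clear implicits.

Section QModule.
Variables (k : fieldType) (n N : nat) (hn : (0 < n)%N) (hN : (0 < N)%N).
Local Notation R := (Rkn k n hn).
Local Notation Q := (Qkn k n N hn hN).

Definition Qscale (r : R) (q : Q) : Q := \pi_Q r * q.

Lemma Qscale_A a b v : Qscale a (Qscale b v) = Qscale (a * b) v.
Proof. by rewrite /Qscale rmorphM mulrA. Qed.
Lemma Qscale_1 : left_id 1 Qscale.
Proof. by move=> v; rewrite /Qscale rmorph1 mul1r. Qed.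
Lemma Qscale_Dr : right_distributive Qscale +%R.
Proof. by move=> a u v; rewrite /Qscale mulrDr. Qed.
Lemma Qscale_Dl v : {morph Qscale^~ v : a b / a + b}.
Proof. by move=> a b; rewrite /Qscale rmorphD mulrDl. Qed.
End QModule.

Definition Qmod (k : fieldType) (n N : nat) (hn : (0 < n)%N) (hN : (0 < N)%N) : Type :=
  Qkn k n N hn hN.
Arguments Qmod : clear implicits.
HB.instance Definition _ k n N hn hN := GRing.Zmodule.on (Qmod k n N hn hN).
HB.instance Definition _ k n N hn hN :=
  GRing.Zmodule_isLmodule.Build (Rkn k n hn) (Qmod k n N hn hN)
    (@Qscale_A k n N hn hN) (@Qscale_1 k n N hn hN)
    (@Qscale_Dr k n N hn hN) (@Qscale_Dl k n N hn hN).

Definition projective (R : pzRingType) (P : lmodType R) : Prop :=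
  forall (M N : lmodType R) (g : {linear M -> N}) (h : {linear P -> N}),
    (forall y : N, exists x : M, g x = y) ->
    exists l : {linear P -> M}, forall p : P, g (l p) = h p.

Definition finite_projdim (R : pzRingType) (M : lmodType R) : Prop :=
  exists (m : nat) (P : nat -> lmodType R)
         (d : forall i : nat, {linear P i.+1 -> P i}) (eps : {linear P 0%N -> M}),
    [/\ forall i, projective (P i),
        forall i, (m < i)%N -> forall x : P i, x = 0,
        forall y : M, exists x : P 0%N, eps x = y,
        forall x : P 0%N, eps x = 0 <-> exists z, d 0%N z = x
      & forall i (x : P i.+1), d i x = 0 <-> exists z, d i.+1 z = x].

Definition has_char (k : fieldType) (c : nat) : Prop :=
  if c == 0%N then [pchar k] =i pred0 else c \in [pchar k].

(* {b/3}: the integer nearest to b/3.  Since b/3 is never a half-integer,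
   this is floor((b+1)/3). *)
Definition near3 (b : nat) : nat := (b + 1) %/ 3.

Definition inT (c a : nat) : Prop :=
  if c == 0%N then False
  else if c == 2%N then is_true (0 < a)%N
  else [/\ prime c, odd c &
        exists (J : int) (e : nat), [/\ odd (absz J), (0 < e)%N &
          ((J * (c ^ e)%:Z - (near3 (c ^ e))%:Z <= a%:Z)
           /\ (a%:Z < J * (c ^ e)%:Z + (near3 (c ^ e))%:Z))%R]].

(* Main.v *)
Require Import Defs.
From HB Require Import structures.
From mathcomp Require Import all_boot all_order all_algebra.
From mathcomp Require Import ring_quotient generic_quotient mpoly.
From mathcomp Require Import ring zify.

Set Implicit Arguments.
Unset Strict Implicit.
Unset Printing Implicit Defensive.

Import GRing.Theory.
Local Open Scope ring_scope.
Local Open Scope quotient_scope.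

(** Put A = k[X, Y] and Z = - X - Y, let L_a be the free rank 2 module of
    triples (u, v, w) with u + v + w = 0, X^a | u, Y^a | v and Z^a | w, and set
    det ((u, v, w), (u', v', w')) = u v' - v u'.  Suppose that L_a has a basis
    of determinant X^a Y^a Z^a one of whose members already lies in L_(a+1).
    Substituting x^n, y^n, z^n for X, Y, Z and distributing powers of x, y, z
    with exponent r or n - r over the entries, one gets a 2 x 3 matrix over R_{k,n}
    with maximal minors x^N, y^N, z^N.  As x^N, y^N is a regular sequence on
    R_{k,n}, the Hilbert-Burch complex of this matrix resolves Q_{k,n,N}.

    To find such a basis, start from a homogeneous basis of L_a, of degrees
    d <= e with d + e = 3a.  If d < e, the vector of degree d is unique up to
    scalars, hence invariant up to scalars under X -> Y -> Z -> X, so the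
    extra divisibility by X, Y, Z holds for all three entries or for none.
    In the first case this vector lies in L_(a+1); in the second, when
    e - d >= 2, a multiple of it with a factor interpolating at the three zeros
    of X, Y, Z corrects the other basis vector into L_(a+1).  The same conclusion
    holds when L_(a+1) has a gap of at least 2 between its two degrees.  Finally,
    if J is odd then the degrees of L_J differ, Frobenius multiplies this gap
    by q, and the gap varies by at most 3 when a varies by 1; so a gap of at
    least 2 occurs at a or a + 1 whenever a is within {q/3} of Jq. *)

(** * Syzygies of powers of three linear forms in two variables *)

Section BinaryForms.
Variables (k : fieldType) (A : idomainType) (C : {rmorphism k -> A}).
Implicit Types (X Y Z u v w f g h p s : A).

Definition rdivides u v := exists s, v = u * s.

(** Forms of degree d in X, Y, Z with coefficients in k; 0 is a form of every degree. Each variable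
    has its own constructor, so that rotating X, Y, Z preserves the predicate case by case. *)
Inductive form X Y Z : nat -> A -> Prop :=
| form_const c : form X Y Z 0 (C c)
| form_add d f g : form X Y Z d f -> form X Y Z d g -> form X Y Z d (f + g)
| form_mulX d f : form X Y Z d f -> form X Y Z d.+1 (X * f)
| form_mulY d f : form X Y Z d f -> form X Y Z d.+1 (Y * f)
| form_mulZ d f : form X Y Z d f -> form X Y Z d.+1 (Z * f).

(** Coprimality of two linear forms, in the shape used below: no nonzero scalar multiple of a power
    of Y vanishes modulo X. *)
Definition indep X Y := forall c m s, X * s = C c * Y ^+ m -> c = 0.

Definition triad X Y Z :=
  [/\ X + Y + Z = 0, indep X Y, indep Y Z & indep Z X].

Lemma triad_rot X Y Z : triad X Y Z -> triad Y Z X.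
Proof. by case=> s0 iXY iYZ iZX; split=> //; rewrite -s0; ring. Qed.

Lemma triad_neq0 X Y Z : triad X Y Z -> X != 0.
Proof.
case=> s0 _ iYZ _; apply/eqP => X0.
have := iYZ (- 1) 1%N 1; rewrite rmorphN1 mulN1r expr1 mulr1.
have -> : Y = - Z by apply/eqP; rewrite -addr_eq0 -s0 X0 add0r.
by move=> /(_ erefl)/eqP; rewrite oppr_eq0 oner_eq0.
Qed.

Lemma form_rot X Y Z d f : form X Y Z d f -> form Y Z X d f.
Proof.
elim=> [c|? ? ? ? ? ? ?|? ? ? ?|? ? ? ?|? ? ? ?].
- exact: form_const.
- exact: form_add.
- exact: form_mulZ.
- exact: form_mulX.
- exact: form_mulY.
Qed.

Lemma form_mul X Y Z d e f g :
  form X Y Z d f -> form X Y Z e g -> form X Y Z (d + e) (f * g).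
Proof.
move=> Hf Hg; elim: Hf => [c|d' f1 f2 _ IH1 _ IH2|d' f1 _ IH|d' f1 _ IH|d' f1 _ IH].
- rewrite add0n; elim: Hg => [c'|d' f1 f2 _ IH1 _ IH2|d' f1 _ IH|d' f1 _ IH|d' f1 _ IH].
  + by rewrite -rmorphM; exact: form_const.
  + by rewrite mulrDr; exact: form_add.
  + by rewrite mulrCA; exact: form_mulX.
  + by rewrite mulrCA; exact: form_mulY.
  + by rewrite mulrCA; exact: form_mulZ.
- by rewrite mulrDl; exact: form_add.
- by rewrite -mulrA; exact: form_mulX.
- by rewrite -mulrA; exact: form_mulY.
- by rewrite -mulrA; exact: form_mulZ.
Qed.

Lemma form_scale X Y Z d c f : form X Y Z d f -> form X Y Z d (C c * f).
Proof. by move=> Hf; rewrite -[d]add0n; apply: form_mul => //; exact: form_const. Qed.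

Lemma form_opp X Y Z d f : form X Y Z d f -> form X Y Z d (- f).
Proof. by move/(form_scale (- 1)); rewrite rmorphN1 mulN1r. Qed.

Lemma form_sub X Y Z d f g :
  form X Y Z d f -> form X Y Z d g -> form X Y Z d (f - g).
Proof. by move=> Hf /form_opp; exact: form_add. Qed.

Lemma form_expr X Y Z d f m : form X Y Z d f -> form X Y Z (m * d) (f ^+ m).
Proof.
move=> Hf; elim: m => [|m IH]; first by rewrite expr0 -(rmorph1 C); exact: form_const.
by rewrite exprS mulSn; exact: form_mul.
Qed.

Lemma form_X X Y Z : form X Y Z 1 X.
Proof.
by rewrite -[X in form _ _ _ _ X]mulr1 -(rmorph1 C); apply/form_mulX/form_const.
Qed.

Lemma form_Y X Y Z : form X Y Z 1 Y.
Proof. exact/form_rot/form_rot/form_X. Qed.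

Lemma form_Z X Y Z : form X Y Z 1 Z.
Proof. exact/form_rot/form_X. Qed.

Lemma form_Xn X Y Z m : form X Y Z m (X ^+ m).
Proof. by have := form_expr m (form_X X Y Z); rewrite muln1. Qed.

Lemma form_Yn X Y Z m : form X Y Z m (Y ^+ m).
Proof. by have := form_expr m (form_Y X Y Z); rewrite muln1. Qed.

Lemma form_Zn X Y Z m : form X Y Z m (Z ^+ m).
Proof. by have := form_expr m (form_Z X Y Z); rewrite muln1. Qed.

(** Forms of degree d - 1, with only 0 in degree -1: the possible cofactors of a linear form in a
    form of degree d. *)
Definition form_pred X Y Z d f := if d is d'.+1 then form X Y Z d' f else f = 0.

Lemma form_pred_add X Y Z d f g :
  form_pred X Y Z d f -> form_pred X Y Z d g -> form_pred X Y Z d (f + g).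
Proof. by case: d => [|d] /=; [move=> -> ->; rewrite addr0 | exact: form_add]. Qed.

Lemma form_pred_mul X Y Z d f g : form X Y Z 1 g ->
  form_pred X Y Z d f -> form X Y Z d (g * f).
Proof.
case: d => [|d] Hg /=; last by rewrite -[d.+1]add1n; exact: form_mul.
by move=> ->; rewrite mulr0 -(rmorph0 C); exact: form_const.
Qed.

(** Modulo X one has Z = - Y, so every monomial of degree d becomes a scalar times Y^d. *)
Lemma form_modX X Y Z d h : triad X Y Z -> form X Y Z d h ->
  exists c, exists2 h', h = C c * Y ^+ d + X * h' & form_pred X Y Z d h'.
Proof.
move=> T; have [s0 _ _ _] := T.
elim=> [c|d' f g Hf [c [f' -> Hf']] Hg [c' [g' -> Hg']]|d' f Hf _|
   d' f Hf [c [f' -> Hf']]|d' f Hf [c [f' Ef Hf']]].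
- by exists c, 0 => //; rewrite mulr0 addr0 expr0 mulr1.
- exists (c + c'), (f' + g'); last exact: form_pred_add.
  by rewrite rmorphD; ring.
- by exists 0, f => //; rewrite rmorph0 mul0r add0r.
- exists c, (Y * f') => /=; last exact: (form_pred_mul (form_Y _ _ _) Hf').
  by rewrite exprS; ring.
- exists (- c), (- f - Y * f') => /=.
    have -> : Z = - X - Y by rewrite -[RHS]addr0 -s0; ring.
    by rewrite rmorphN exprS Ef; ring.
  apply: form_sub; first exact: form_opp.
  exact: (form_pred_mul (form_Y _ _ _) Hf').
Qed.

Lemma form0_const X Y Z f : triad X Y Z -> form X Y Z 0 f -> exists c, f = C c.
Proof.
move=> T /(form_modX T)[c [h' -> /= ->]].
by exists c; rewrite mulr0 addr0 expr0 mulr1.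
Qed.

Lemma form_divX X Y Z t d p : triad X Y Z -> form X Y Z d (X ^+ t * p) ->
  p = 0 \/ exists2 i, d = (t + i)%N & form X Y Z i p.
Proof.
move=> T; have [_ iXY _ _] := T; have X0 := triad_neq0 T.
elim: t d => [|t IH] d; first by rewrite mul1r; right; exists d.
move=> /(form_modX T)[c [h' E Hh']].
have c0 : c = 0.
  apply: (iXY c d (X ^+ t * p - h')).
  by rewrite mulrBr mulrA -exprS E; ring.
move: E; rewrite c0 rmorph0 mul0r add0r exprS -mulrA => /(mulfI X0) E.
case: d Hh' => [|d] /= Hh'.
  by left; move: E; rewrite Hh' => /eqP; rewrite mulf_eq0 expf_eq0 (negPf X0) andbF => /eqP.
rewrite -E in Hh'; case: (IH _ Hh') => [->|[i -> Hi]]; first by left.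
by right; exists i.
Qed.

Lemma form_divXYZ X Y Z a d p : triad X Y Z ->
  form X Y Z d (X ^+ a * Y ^+ a * Z ^+ a * p) ->
  p = 0 \/ exists2 i, d = (3 * a + i)%N & form X Y Z i p.
Proof.
move=> T; have TY := triad_rot T; have TZ := triad_rot TY.
have [X0 Y0 Z0] : [/\ X != 0, Y != 0 & Z != 0]
  by split; [exact: triad_neq0 T|exact: triad_neq0 TY|exact: triad_neq0 TZ].
rewrite -2!mulrA => /(form_divX T)[/eqP|[i -> /form_rot/(form_divX TY)[/eqP|]]];
  last move=> [j -> /form_rot/(form_divX TZ)[/eqP|[l -> Hl]]].
- by rewrite !mulf_eq0 !expf_eq0 (negPf Y0) (negPf Z0) !andbF => /eqP; left.
- by rewrite mulf_eq0 expf_eq0 (negPf Z0) andbF => /eqP; left.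
- by move=> /eqP; left.
- by right; exists l; [lia | exact: form_rot].
Qed.

(** If p = c Y^i modulo X, then c Y^(a + i) vanishes modulo X, so c = 0; one factor X is cancelled
    and the argument repeats. *)
Lemma form_coprime X Y Z a b i p s : triad X Y Z -> form X Y Z i p ->
  Y ^+ a * p = X ^+ b * s -> rdivides (X ^+ b) p.
Proof.
move=> T; have [_ iXY _ _] := T; have X0 := triad_neq0 T.
elim: b i p => [|b IH] i p Hp E; first by exists p; rewrite mul1r.
have [c [h' Ep Hh']] := form_modX T Hp.
have c0 : c = 0.
  apply: (iXY c (a + i)%N (X ^+ b * s - Y ^+ a * h')).
  rewrite mulrBr mulrA -exprS -E Ep exprD; ring.
move: Ep; rewrite c0 rmorph0 mul0r add0r => Ep.
have {}E : Y ^+ a * h' = X ^+ b * s.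
  by apply: (mulfI X0); rewrite mulrCA -Ep E exprS mulrA.
case: i Hp Hh' => [|i] Hp /= Hh'.
  by exists 0; rewrite Ep Hh' !mulr0.
by have [s' Es'] := IH _ _ Hh' E; exists s'; rewrite Ep Es' exprS mulrA.
Qed.

(** The three exponents are kept apart so that bases can be built by raising one of them at a
    time. *)
Definition syz X Y Z t1 t2 t3 u v w :=
  u + v + w = 0 /\
  [/\ rdivides (X ^+ t1) u, rdivides (Y ^+ t2) v & rdivides (Z ^+ t3) w].

Definition form3 X Y Z d u v w := [/\ form X Y Z d u, form X Y Z d v & form X Y Z d w].

(** The determinant condition encodes being a basis: for equal exponents, the determinant of any two
    homogeneous syzygies is a multiple of this product ([det_divides]), so Cramer's rule gives
    coordinates in A. *)
Definition hom_basis X Y Z t1 t2 t3 d e := exists u v w u' v' w',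
  [/\ syz X Y Z t1 t2 t3 u v w, form3 X Y Z d u v w,
      syz X Y Z t1 t2 t3 u' v' w', form3 X Y Z e u' v' w' &
      u * v' - v * u' = X ^+ t1 * Y ^+ t2 * Z ^+ t3].

Lemma rdivides_mull p u v : rdivides u v -> rdivides u (p * v).
Proof. by case=> s ->; exists (p * s); rewrite mulrCA. Qed.

Lemma rdivides_add u v w : rdivides u v -> rdivides u w -> rdivides u (v + w).
Proof. by case=> s -> [s' ->]; exists (s + s'); rewrite mulrDr. Qed.

Lemma rdivides_opp u v : rdivides u v -> rdivides u (- v).
Proof. by case=> s ->; exists (- s); rewrite mulrN. Qed.

Lemma rdivides_trans u v w : rdivides u v -> rdivides v w -> rdivides u w.
Proof. by case=> s -> [s' ->]; exists (s * s'); rewrite mulrA. Qed.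

Lemma rdivides_mulX X m u : rdivides (X ^+ m) u -> rdivides (X ^+ m.+1) (X * u).
Proof. by case=> s ->; exists s; rewrite exprS mulrA. Qed.

Lemma rdivides_exp X m l u : (m <= l)%N -> rdivides (X ^+ l) u -> rdivides (X ^+ m) u.
Proof. by move=> ml; apply: rdivides_trans; exists (X ^+ (l - m)); rewrite -exprD subnKC. Qed.

Lemma syz_rot X Y Z t1 t2 t3 u v w :
  syz X Y Z t1 t2 t3 u v w -> syz Y Z X t2 t3 t1 v w u.
Proof. by case=> s0 [? ? ?]; split=> //; rewrite -s0; ring. Qed.

Lemma form3_rot X Y Z d u v w : form3 X Y Z d u v w -> form3 Y Z X d v w u.
Proof. by case=> *; split; exact: form_rot. Qed.

Lemma syz_opp X Y Z t1 t2 t3 u v w :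
  syz X Y Z t1 t2 t3 u v w -> syz X Y Z t1 t2 t3 (- u) (- v) (- w).
Proof.
by case=> s0 [? ? ?]; split; [rewrite -!opprD s0 oppr0|split; exact: rdivides_opp].
Qed.

Lemma det_rot u v w u' v' w' : u + v + w = 0 -> u' + v' + w' = 0 ->
  v * w' - w * v' = u * v' - v * u'.
Proof.
move=> /eqP; rewrite addr_eq0 => /eqP s0 /eqP; rewrite addr_eq0 => /eqP s0'.
by rewrite -[w]opprK -s0 -[w']opprK -s0'; ring.
Qed.

Lemma hom_basis_rot X Y Z t1 t2 t3 d e :
  hom_basis X Y Z t1 t2 t3 d e -> hom_basis Y Z X t2 t3 t1 d e.
Proof.
case=> u [v [w [u' [v' [w' [S F S' F' D]]]]]]; exists v, w, u, v', w', u'.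
split; [exact: syz_rot|exact: form3_rot|exact: syz_rot|exact: form3_rot|].
by rewrite (det_rot S.1 S'.1) D [RHS]mulrC mulrA.
Qed.

Lemma hom_basis_swap X Y Z t1 t2 t3 d e :
  hom_basis X Y Z t1 t2 t3 d e -> hom_basis X Y Z t1 t2 t3 e d.
Proof.
case=> u [v [w [u' [v' [w' [S [F1 F2 F3] S' F' D]]]]]].
exists u', v', w', (- u), (- v), (- w).
split=> //; [exact: syz_opp|by split; exact: form_opp|].
by rewrite -D; ring.
Qed.

Lemma form_leadX X Y Z t d u : triad X Y Z -> form X Y Z d u -> rdivides (X ^+ t) u ->
  exists c s, u = X ^+ t * (C c * Y ^+ (d - t) + X * s) /\ (c = 0 \/ (t <= d)%N).
Proof.
move=> T Fu [p Ep]; move: Fu; rewrite Ep => /(form_divX T)[->|[i -> Fp]].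
  by exists 0, 0; split; [rewrite rmorph0 mul0r !mulr0 addr0 mulr0|left].
have [c [h' -> _]] := form_modX T Fp.
by exists c, h'; rewrite addKn leq_addr; split=> //; right.
Qed.

(** Let c and c' be the coefficients of u / X^t1 and u' / X^t1 modulo X. If c = 0, the first vector
    already has the extra factor X and the second is multiplied by X. Otherwise (c'/c) Y^(e - d)
    times the first vector is subtracted from the second, and the first is multiplied by X. Both
    ways the determinant gains one factor X. *)
Lemma hom_basis_stepX X Y Z t1 t2 t3 d e : triad X Y Z -> (d <= e)%N ->
  hom_basis X Y Z t1 t2 t3 d e ->
  hom_basis X Y Z t1.+1 t2 t3 d e.+1 \/ hom_basis X Y Z t1.+1 t2 t3 d.+1 e.
Proof.
move=> T de [u [v [w [u' [v' [w' [S [Fu Fv Fw] S' [Fu' Fv' Fw'] D]]]]]]].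
have [s0 [Du Dv Dw]] := S; have [s0' [Du' Dv' Dw']] := S'.
have DX : X ^+ t1.+1 * Y ^+ t2 * Z ^+ t3 = X * (u * v' - v * u').
  by rewrite D exprS !mulrA.
have [c [s [Eu Hc]]] := form_leadX T Fu Du.
have [c' [s' [Eu' Hc']]] := form_leadX T Fu' Du'.
case: (eqVneq c 0) Hc => [c0|c0] Hc.
  left; exists u, v, w, (X * u'), (X * v'), (X * w'); split.
  - split=> //; split=> //; exists s.
    by rewrite Eu c0 rmorph0 mul0r add0r exprSr mulrA.
  - by [].
  - split; first by rewrite -!mulrDr s0' mulr0.
    by split; [exact: rdivides_mulX|exact: rdivides_mull..].
  - by split; exact: form_mulX.
  - by rewrite DX; ring.
case: Hc => [c0'|td]; first by rewrite c0' eqxx in c0.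
right; pose l := C (- (c' / c)) * Y ^+ (e - d).
have Fl x x' : form X Y Z d x -> form X Y Z e x' -> form X Y Z e (l * x + x').
  move=> Fx Fx'; apply: form_add => //; rewrite /l -mulrA.
  apply: form_scale.
  by rewrite -(subnK de) addnK; apply: form_mul => //; exact: form_Yn.
exists (X * u), (X * v), (X * w), (l * u + u'), (l * v + v'), (l * w + w'); split.
- split; first by rewrite -!mulrDr s0 mulr0.
  by split; [exact: rdivides_mulX|exact: rdivides_mull..].
- by split; exact: form_mulX.
- split; first by rewrite -[RHS](mulr0 l) -[RHS]addr0 -{1}s0 -s0'; ring.
  split; last 2 first.
  + by apply: rdivides_add => //; exact: rdivides_mull.
  + by apply: rdivides_add => //; exact: rdivides_mull.
  exists (l * s + s').
  have Ec' : C c' = C (c' / c) * C c by rewrite -rmorphM mulfVK.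
  have -> : u' = X ^+ t1 * (C c' * Y ^+ (e - d) * Y ^+ (d - t1) + X * s').
    by rewrite Eu' -(mulrA (C c')) -exprD addnBA // subnK.
  by rewrite Eu Ec' /l rmorphN exprSr; ring.
- by split; exact: Fl.
- by rewrite DX; ring.
Qed.

Lemma hom_basis_sorted_stepX X Y Z t1 t2 t3 : triad X Y Z ->
  (exists d e, [/\ (d <= e)%N, (d + e = t1 + t2 + t3)%N & hom_basis X Y Z t1 t2 t3 d e]) ->
  exists d e, [/\ (d <= e)%N, (d + e = t1.+1 + t2 + t3)%N
                & hom_basis X Y Z t1.+1 t2 t3 d e].
Proof.
move=> T [d [e [de s B]]]; case: (hom_basis_stepX T de B) => B'.
  by exists d, e.+1; split=> //; lia.
case: (ltnP d e) => de'; first by exists d.+1, e; split=> //; lia.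
by exists e, d.+1; split; [lia|lia|exact: hom_basis_swap].
Qed.

Lemma hom_basis_exists X Y Z a : triad X Y Z ->
  exists d e, [/\ (d <= e)%N, (d + e = 3 * a)%N & hom_basis X Y Z a a a d e].
Proof.
move=> T; have TY := triad_rot T; have TZ := triad_rot TY.
elim: a => [|a [d [e [de s B]]]].
  (* For a = 0 the constant vectors (1, -1, 0) and (0, 1, -1) have determinant 1. *)
  exists 0%N, 0%N; split=> //; exists 1, (- 1), 0, 0, 1, (- 1).
  have F0 : form X Y Z 0 0 by rewrite -(rmorph0 C); exact: form_const.
  have F1 : form X Y Z 0 1 by rewrite -(rmorph1 C); exact: form_const.
  have FN : form X Y Z 0 (- 1) by exact: form_opp.
  have dv1 u v : rdivides (u ^+ 0) v by exists v; rewrite mul1r.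
  by split=> //; try (by split=> //; ring); rewrite !expr0; ring.
have : exists d e, [/\ (d <= e)%N, (d + e = a + a + a)%N & hom_basis X Y Z a a a d e].
  by exists d, e; split=> //; lia.
move=> /(hom_basis_sorted_stepX T)[d1 [e1 [l1 s1 B1]]].
have /(hom_basis_sorted_stepX TY)[d2 [e2 [l2 s2 B2]]] : exists d e,
    [/\ (d <= e)%N, (d + e = a + a + a.+1)%N & hom_basis Y Z X a a a.+1 d e].
  by exists d1, e1; split; [|lia|exact: hom_basis_rot].
have /(hom_basis_sorted_stepX TZ)[d3 [e3 [l3 s3 B3]]] : exists d e,
    [/\ (d <= e)%N, (d + e = a + a.+1 + a.+1)%N & hom_basis Z X Y a a.+1 a.+1 d e].
  by exists d2, e2; split; [|lia|exact: hom_basis_rot].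
by exists d3, e3; split; [|lia|exact: hom_basis_rot].
Qed.

Lemma det_form X Y Z d e u v w u' v' w' :
  form3 X Y Z d u v w -> form3 X Y Z e u' v' w' ->
  form X Y Z (d + e) (u * v' - v * u').
Proof. by move=> [? ? ?] [? ? ?]; apply: form_sub; exact: form_mul. Qed.

(** The first two columns give the factor X^a Y^a. Since both rows sum to 0, the last two columns
    have the same determinant, which gives Z^a; coprimality of Z and X combines the two. *)
Lemma det_divides X Y Z a d e u v w u' v' w' : triad X Y Z ->
  syz X Y Z a a a u v w -> form3 X Y Z d u v w ->
  syz X Y Z a a a u' v' w' -> form3 X Y Z e u' v' w' ->
  rdivides (X ^+ a * Y ^+ a * Z ^+ a) (u * v' - v * u').
Proof.
move=> T S F S' F'; have TY := triad_rot T; have TZ := triad_rot TY.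
have FD := det_form F F'; have E := det_rot S.1 S'.1.
have [_ [[al Eu] [be Ev] [ga Ew]]] := S; have [_ [[al' Eu'] [be' Ev'] [ga' Ew']]] := S'.
pose p := al * be' - be * al'.
have Ep : u * v' - v * u' = X ^+ a * (Y ^+ a * p) by rewrite Eu Ev Eu' Ev' /p; ring.
have {}E : X ^+ a * p = Z ^+ a * (be * ga' - ga * be').
  apply: (@mulfI _ (Y ^+ a)); first by rewrite expf_neq0 // (triad_neq0 TY).
  by rewrite mulrCA -Ep -E Ev Ew Ev' Ew'; ring.
rewrite Ep in FD *.
have [/eqP|[i _ /form_rot /(form_divX TY)[p0|[j _ /form_rot Fp]]]] := form_divX T FD.
- rewrite mulf_eq0 expf_eq0 (negPf (triad_neq0 TY)) andbF /= => /eqP ->.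
  by exists 0; rewrite !mulr0.
- by exists 0; rewrite p0 !mulr0.
- by have [s ->] := form_coprime TZ Fp E; exists s; ring.
Qed.

Lemma cramer u v u' v' x1 x2 :
  (u * v' - v * u') * x1 = (x1 * v' - x2 * u') * u + (u * x2 - v * x1) * u'
  /\ (u * v' - v * u') * x2 = (x1 * v' - x2 * u') * v + (u * x2 - v * x1) * v'.
Proof. by split; ring. Qed.

Lemma XYZ_neq0 X Y Z a : triad X Y Z -> X ^+ a * Y ^+ a * Z ^+ a != 0.
Proof.
move=> T; have TY := triad_rot T; have TZ := triad_rot TY.
by rewrite !mulf_neq0 ?expf_neq0 ?(triad_neq0 T) ?(triad_neq0 TY) ?(triad_neq0 TZ).
Qed.

(** Cramer's rule, with degrees. The last two clauses serve to kill a coefficient whenever r is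
    below the degree of its basis vector. *)
Lemma basis_decomp X Y Z a d e u v w u' v' w' r x1 x2 x3 : triad X Y Z ->
  syz X Y Z a a a u v w -> form3 X Y Z d u v w ->
  syz X Y Z a a a u' v' w' -> form3 X Y Z e u' v' w' ->
  u * v' - v * u' = X ^+ a * Y ^+ a * Z ^+ a -> (d + e = 3 * a)%N ->
  syz X Y Z a a a x1 x2 x3 -> form3 X Y Z r x1 x2 x3 ->
  exists f g, [/\ [/\ x1 = f * u + g * u', x2 = f * v + g * v' & x3 = f * w + g * w'],
    x1 * v' - x2 * u' = f * (X ^+ a * Y ^+ a * Z ^+ a) /\
    u * x2 - v * x1 = g * (X ^+ a * Y ^+ a * Z ^+ a),
    f = 0 \/ exists2 i, r = (d + i)%N & form X Y Z i f
    & g = 0 \/ exists2 i, r = (e + i)%N & form X Y Z i g].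
Proof.
move=> T S F S' F' D de Sx Fx.
have [f Ef] := det_divides T Sx Fx S' F'; have [g Eg] := det_divides T S F Sx Fx.
have D0 := XYZ_neq0 a T.
have [C1 C2] := cramer u v u' v' x1 x2.
have E1 : x1 = f * u + g * u' by apply: (mulfI D0); rewrite -D C1 Ef Eg D; ring.
have E2 : x2 = f * v + g * v' by apply: (mulfI D0); rewrite -D C2 Ef Eg D; ring.
have E3 : x3 = f * w + g * w'.
  have sum0 (a1 a2 a3 : A) : a1 + a2 + a3 = 0 -> a3 = - (a1 + a2).
    by move=> /eqP; rewrite addrC addr_eq0 => /eqP.
  rewrite (sum0 _ _ _ Sx.1) (sum0 _ _ _ S.1) (sum0 _ _ _ S'.1) E1 E2; ring.
exists f, g; split=> //; first by rewrite Ef Eg; split; exact: mulrC.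
- have := det_form Fx F'; rewrite Ef => /(form_divXYZ T)[|[i Ei Fi]]; first by left.
  by right; exists i => //; lia.
- have := det_form F Fx; rewrite Eg => /(form_divXYZ T)[|[i Ei Fi]]; first by left.
  by right; exists i => //; lia.
Qed.

(** Modulo X, the factor Y^(e - d - 1) Z is - Y^(e - d), so m is the quotient of the two leading
    coefficients. The free multiple X s leaves room for corrections at the zeros of Y and Z. *)
Lemma kill_leadX X Y Z a d e u u' : triad X Y Z -> (d.+2 <= e)%N ->
  form X Y Z d u -> form X Y Z e u' ->
  rdivides (X ^+ a) u -> rdivides (X ^+ a) u' -> ~ rdivides (X ^+ a.+1) u ->
  exists m, forall s,
    rdivides (X ^+ a.+1) (u' + (C m * Y ^+ (e - d).-1 * Z + X * s) * u).
Proof.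
move=> T de Fu Fu' Du Du' nDu; have [s0 _ _ _] := T.
have [c [s1 [Eu Hc]]] := form_leadX T Fu Du.
have [c' [s2 [Eu' _]]] := form_leadX T Fu' Du'.
have c0 : c != 0.
  apply/eqP => c0; apply: nDu; exists s1.
  by rewrite Eu c0 rmorph0 mul0r add0r exprSr mulrA.
have ad : (a <= d)%N by case: Hc => // cz; rewrite cz eqxx in c0.
exists (c' / c) => s.
set P := Y ^+ (e - d).-1; set Q := Y ^+ (d - a) in Eu.
have {}Eu' : u' = X ^+ a * (C (c' / c) * C c * (P * Y * Q) + X * s2).
  rewrite -rmorphM mulfVK // Eu' /P /Q -exprSr -exprD.
  by congr (_ * (_ * Y ^+ _ + _)); lia.
have -> : Z = - X - Y by rewrite -[RHS]addr0 -s0; ring.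
exists (s2 - C (c' / c) * P * C c * Q + C (c' / c) * P * (- X - Y) * s1
        + s * (C c * Q + X * s1)).
by rewrite Eu Eu' exprSr; ring.
Qed.

(** As u has exactly a factors X, the missing one must come from f: modulo X the product of the
    leading coefficients of f and u is 0. *)
Lemma form1_dividesX X Y Z a d f u s : triad X Y Z -> form X Y Z d u ->
  rdivides (X ^+ a) u -> ~ rdivides (X ^+ a.+1) u ->
  form X Y Z 1 f -> f * u = X ^+ a.+1 * s -> exists c, f = X * C c.
Proof.
move=> T Fu Du nDu Ff E; have [_ iXY _ _] := T.
have [c [s1 [Eu _]]] := form_leadX T Fu Du.
have c0 : c != 0.
  apply/eqP => c0; apply: nDu; exists s1.
  by rewrite Eu c0 rmorph0 mul0r add0r exprSr mulrA.
have [b [f' Ef Ff']] := form_modX T Ff.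
rewrite expr1 in Ef; have [b' Eb'] := form0_const T Ff'.
have b0 : b = 0.
  have /eqP : b * c = 0; last by rewrite mulf_eq0 (negPf c0) orbF => /eqP.
  apply: (iXY _ (d - a).+1 (s - (f' * (C c * Y ^+ (d - a) + X * s1) + C b * Y * s1))).
  apply: (@mulfI _ (X ^+ a)); first by rewrite expf_neq0 // (triad_neq0 T).
  have {}E : X ^+ a * (X * s) = f * u by rewrite E exprSr mulrA.
  by rewrite mulrBr mulrBr E Ef Eu rmorphM exprS; ring.
by exists b'; rewrite Ef b0 rmorph0 mul0r add0r Eb'.
Qed.

(** * Cyclic symmetry and degree gaps *)

Section Symmetry.
Variables (X Y Z : A) (pi : {rmorphism A -> A}).
Hypotheses (T : triad X Y Z) (piC : forall c, pi (C c) = C c).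
Hypotheses (piX : pi X = Y) (piY : pi Y = Z) (piZ : pi Z = X).

Lemma form_pi d f : form X Y Z d f -> form X Y Z d (pi f).
Proof.
elim=> [c|? ? ? ? ? ? ?|? ? ? ?|? ? ? ?|? ? ? ?].
- by rewrite piC; exact: form_const.
- by rewrite rmorphD; exact: form_add.
- by rewrite rmorphM piX; exact: form_mulY.
- by rewrite rmorphM piY; exact: form_mulZ.
- by rewrite rmorphM piZ; exact: form_mulX.
Qed.

Lemma form_pi3 d f : form X Y Z d f -> pi (pi (pi f)) = f.
Proof.
elim=> [c|? ? ? ? E1 ? E2|? ? ? E|? ? ? E|? ? ? E].
- by rewrite !piC.
- by rewrite !rmorphD E1 E2.
- by rewrite !rmorphM E piX piY piZ.
- by rewrite !rmorphM E piY piZ piX.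
- by rewrite !rmorphM E piZ piX piY.
Qed.

Lemma rdivides_pi u v : rdivides u v -> rdivides (pi u) (pi v).
Proof. by case=> s ->; exists (pi s); rewrite rmorphM. Qed.

Lemma low_vector_symmetric a d e u v w u' v' w' :
  syz X Y Z a a a u v w -> form3 X Y Z d u v w ->
  syz X Y Z a a a u' v' w' -> form3 X Y Z e u' v' w' ->
  u * v' - v * u' = X ^+ a * Y ^+ a * Z ^+ a -> (d + e = 3 * a)%N -> (d < e)%N ->
  [/\ rdivides (X ^+ a.+1) u -> rdivides (Y ^+ a.+1) v,
      rdivides (Y ^+ a.+1) v -> rdivides (Z ^+ a.+1) w &
      rdivides (Z ^+ a.+1) w -> rdivides (X ^+ a.+1) u].
Proof.
move=> S F S' F' D de lt.
have Sp : syz X Y Z a a a (pi w) (pi u) (pi v).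
  case: S => s0 [Du Dv Dw]; split.
    by rewrite -(rmorph0 pi) -s0 !rmorphD; ring.
  by split; [rewrite -piZ|rewrite -piX|rewrite -piY]; rewrite -rmorphXn; exact: rdivides_pi.
have [Fu Fv Fw] := F.
have Fp : form3 X Y Z d (pi w) (pi u) (pi v) by split; exact: form_pi.
have [f [g [[E1 E2 E3] _ Hf Hg]]] := basis_decomp T S F S' F' D de Sp Fp.
have g0 : g = 0 by case: Hg => // -[i]; lia.
have [c Ec] : exists c, f = C c.
  case: Hf => [->|[i Ei Ff]]; first by exists 0; rewrite rmorph0.
  by apply: (form0_const T); have <- : i = 0%N by lia.
rewrite g0 !mul0r !addr0 Ec in E1 E2 E3.
(* For c = 0 both u and v are killed by [pi], hence are 0 because [pi] has order 3 on forms; the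
   determinant would vanish. *)
have c0 : c != 0.
  apply/eqP => c0; rewrite c0 rmorph0 !mul0r in E2 E3.
  have u0 : u = 0 by rewrite -(form_pi3 Fu) E2 !rmorph0.
  have v0 : v = 0 by rewrite -(form_pi3 Fv) E3 !rmorph0.
  by have := XYZ_neq0 a T; rewrite -D u0 v0 !mul0r subr0 eqxx.
have canc x y t : pi x = C c * y -> rdivides t (pi x) -> rdivides t y.
  move=> -> /(rdivides_mull (C c^-1)).
  by rewrite mulrA -rmorphM mulVf // rmorph1 mul1r.
split=> /rdivides_pi; rewrite rmorphXn /= ?piX ?piY ?piZ; exact: canc.
Qed.

Definition split_basis a := exists u v w u' v' w',
  [/\ syz X Y Z a.+1 a.+1 a.+1 u v w, syz X Y Z a a a u' v' w' &
      u * v' - v * u' = X ^+ a * Y ^+ a * Z ^+ a].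

(** A certificate that the lower degree of a homogeneous basis of L_a is at most r, hence that the
    gap is at least 3a - 2r. *)
Definition short_syz a r := exists u v w,
  [/\ ~ (u = 0 /\ v = 0), form3 X Y Z r u v w & syz X Y Z a a a u v w].

(** The degrees of a basis sum to the odd number 3J, so they differ. *)
Lemma short_syz_odd J : odd J -> exists2 d, (2 * d < 3 * J)%N & short_syz J d.
Proof.
move=> oJ; have [d [e [de s [u [v [w [u' [v' [w' [S F _ _ D]]]]]]]]]] :=
  hom_basis_exists J T.
exists d; first lia.
exists u, v, w; split=> // -[u0 v0].
by have := XYZ_neq0 J T; rewrite -D u0 v0 !mul0r subr0 eqxx.
Qed.

Lemma short_syz_Frobenius (p e J d : nat) : p \in [pchar A] ->
  short_syz J d -> short_syz (J * p ^ e) (p ^ e * d).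
Proof.
move=> hp [u [v [w [nz [Fu Fv Fw] [s0 [[a Ea] [b Eb] [c Ec]]]]]]].
have pp := pcharf_prime hp.
have q0 : (p ^ e != 0)%N by rewrite -lt0n expn_gt0 prime_gt0.
have pn : [pchar A].-nat (p ^ e)%N.
  by rewrite (eq_pnat _ (pcharf_eq hp)) pnatX pnat_id.
exists (u ^+ (p ^ e)), (v ^+ (p ^ e)), (w ^+ (p ^ e)); split.
- move=> [/eqP + /eqP]; rewrite !expf_eq0 => /andP[_ /eqP u0] /andP[_ /eqP v0].
  exact: nz.
- by split; exact: form_expr.
- split.
    by rewrite -!exprDn_pchar // s0 expr0n (negPf q0).
  by split; rewrite exprM; [rewrite Ea|rewrite Eb|rewrite Ec];
    rewrite exprMn; eexists.
Qed.

Lemma short_syz_up (a s r : nat) : short_syz a r -> short_syz (a + s) (3 * s + r).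
Proof.
move=> [u [v [w [nz [Fu Fv Fw] [s0 [[al Ea] [be Eb] [ga Ec]]]]]]].
pose m := X ^+ s * Y ^+ s * Z ^+ s.
have m0 : m != 0 by exact: (XYZ_neq0 s T).
have Fm x : form X Y Z r x -> form X Y Z (3 * s + r) (m * x).
  move=> Fx; apply: form_mul => //.
  have -> : (3 * s = s + s + s)%N by lia.
  by do !apply: form_mul; [exact: form_Xn|exact: form_Yn|exact: form_Zn].
exists (m * u), (m * v), (m * w); split.
- by move=> [Eu Ev]; apply: nz; split; apply: (mulfI m0); rewrite mulr0.
- by split; exact: Fm.
- split; first by rewrite -!mulrDr s0 mulr0.
  rewrite /m !exprD; split.
  + by exists (Y ^+ s * Z ^+ s * al); rewrite Ea; ring.
  + by exists (X ^+ s * Z ^+ s * be); rewrite Eb; ring.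
  + by exists (X ^+ s * Y ^+ s * ga); rewrite Ec; ring.
Qed.

Lemma short_syz_down a b r : (b <= a)%N -> short_syz a r -> short_syz b r.
Proof.
move=> ba [u [v [w [nz F [s0 [Du Dv Dw]]]]]]; exists u, v, w; split=> //.
by split=> //; split; exact: (rdivides_exp ba).
Qed.

(** The two alternatives say that the gap is at least 2 at a, respectively at a + 1. *)
Lemma split_basis_short a r :
  short_syz a r /\ (2 * r + 2 <= 3 * a)%N \/
  short_syz a.+1 r /\ (2 * r <= 3 * a + 1)%N -> split_basis a.
Proof.
move=> short; have TY := triad_rot T; have TZ := triad_rot TY.
have [d [e [de s [u [v [w [u' [v' [w' [S F S' F' D]]]]]]]]]] := hom_basis_exists a T.
have [s0 [Du Dv Dw]] := S; have [Fu Fv Fw] := F.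
have [s0' [Du' Dv' Dw']] := S'; have [Fu' Fv' Fw'] := F'.
have Fr x i : form X Y Z i x -> form Y Z X i x /\ form Z X Y i x.
  by move=> Fx; split; [exact: form_rot|exact/form_rot/form_rot].
case: (pboolP (syz X Y Z a.+1 a.+1 a.+1 u v w)) => [Su|nSu].
  by exists u, v, w, u', v', w'.
have none : (d < e)%N -> [/\ ~ rdivides (X ^+ a.+1) u, ~ rdivides (Y ^+ a.+1) v
    & ~ rdivides (Z ^+ a.+1) w].
  move=> lt.
  have [HX HY HZ] := low_vector_symmetric S F S' F' D s lt.
  by split=> H; apply: nSu; split=> //; split; auto.
case: (leqP d.+2 e) => gap.
  have [nX nY nZ] : [/\ ~ rdivides (X ^+ a.+1) u, ~ rdivides (Y ^+ a.+1) v
    & ~ rdivides (Z ^+ a.+1) w] by apply: none; lia.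
  have [m1 K1] := kill_leadX T gap Fu Fu' Du Du' nX.
  have [m2 K2] := kill_leadX TY gap (Fr _ _ Fv).1 (Fr _ _ Fv').1 Dv Dv' nY.
  have [m3 K3] := kill_leadX TZ gap (Fr _ _ Fw).2 (Fr _ _ Fw').2 Dw Dw' nZ.
  (* The gap of at least 2 makes this exponent positive, so modulo each of X, Y, Z only one summand
     of [l] survives. *)
  have [i Ei] : exists i, (e - d).-1 = i.+1 by exists (e - d).-2; lia.
  rewrite Ei in K1 K2 K3.
  (* [l] interpolates the required values at the three zeros of X, Y and Z *)
  pose l := C m1 * Y ^+ i.+1 * Z + C m2 * Z ^+ i.+1 * X + C m3 * X ^+ i.+1 * Y.
  (* The corrected vector is moved to the first place; the sign restores the determinant. *)
  exists (- (u' + l * u)), (- (v' + l * v)), (- (w' + l * w)), u, v, w; split=> //.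
    apply: syz_opp; split.
      by rewrite -[RHS](mulr0 l) -[RHS]add0r -{1}s0' -s0; ring.
    have E1 : l = C m1 * Y ^+ i.+1 * Z + X * (C m2 * Z ^+ i.+1 + C m3 * X ^+ i * Y).
      by rewrite /l (exprS X); ring.
    have E2 : l = C m2 * Z ^+ i.+1 * X + Y * (C m3 * X ^+ i.+1 + C m1 * Y ^+ i * Z).
      by rewrite /l (exprS Y); ring.
    have E3 : l = C m3 * X ^+ i.+1 * Y + Z * (C m1 * Y ^+ i.+1 + C m2 * Z ^+ i * X).
      by rewrite /l (exprS Z); ring.
    by split; [rewrite E1; exact: K1|rewrite E2; exact: K2|rewrite E3; exact: K3].
  by rewrite -D; ring.
have [x [y [z [nz Fx Sx]]]] : short_syz a r.
  by case: short => [[]//|[H _]]; apply: short_syz_down H.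
(* Now e <= d + 1. The first alternative would give r < d, so the short vector would be 0. In the
   second, r <= d + 1 and r <= e. *)
case: short => [[_ small]|[[{}x [{}y [{}z [{}nz {}Fx {}Sx]]]] small]].
  have [f [g [[E1 E2 _] _ Hf Hg]]] := basis_decomp T S F S' F' D s Sx Fx.
  have f0 : f = 0 by case: Hf => // -[i]; lia.
  have g0 : g = 0 by case: Hg => // -[i]; lia.
  by case: nz; rewrite E1 E2 f0 g0 !mul0r addr0.
have Sxa : syz X Y Z a a a x y z.
  by case: Sx => s1 [? ? ?]; split=> //; split; exact: (rdivides_exp (leqnSn a)).
have [f [g [[E1 E2 E3] [Df Dg] Hf Hg]]] := basis_decomp T S F S' F' D s Sxa Fx.
have syzC c t1 t2 t3 : syz X Y Z t1 t2 t3 x y z ->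
    syz X Y Z t1 t2 t3 (C c * x) (C c * y) (C c * z).
  move=> [s1 [? ? ?]]; split; first by rewrite -!mulrDr s1 mulr0.
  by split; exact: rdivides_mull.
(* A nonzero g is a constant, so the short vector of L_(a+1), rescaled, can replace the second basis
   vector. *)
case: (eqVneq g 0) => [g0|g0]; last first.
  case: Hg => [gz|[i Ei Fg]]; first by rewrite gz eqxx in g0.
  have i0 : i = 0%N by lia.
  rewrite i0 in Fg; have [c Ec] := form0_const T Fg.
  have c0 : c != 0 by rewrite -(fmorph_eq0 C) -Ec.
  exists (C (- c^-1) * x), (C (- c^-1) * y), (C (- c^-1) * z), u, v, w; split=> //.
    exact: syzC.
  have -> : C (- c^-1) * x * v - C (- c^-1) * y * u = C c^-1 * (u * y - v * x).
    by rewrite rmorphN; ring.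
  by rewrite Dg Ec mulrA -rmorphM mulVf // rmorph1 mul1r.
case: Hf => [f0|[i Ei Ff]].
  by case: nz; rewrite E1 E2 f0 g0 !mul0r addr0.
have [f0|f0] := eqVneq f 0.
  by case: nz; rewrite E1 E2 f0 g0 !mul0r addr0.
case: i Ei Ff => [|i] Ei Ff.
  have [c Ec] := form0_const T Ff.
  have c0 : c != 0 by rewrite -(fmorph_eq0 C) -Ec.
  exists (C c^-1 * x), (C c^-1 * y), (C c^-1 * z), u', v', w'; split=> //.
    exact: syzC.
  have -> : C c^-1 * x * v' - C c^-1 * y * u' = C c^-1 * (x * v' - y * u') by ring.
  by rewrite Df Ec mulrA -rmorphM mulVf // rmorph1 mul1r.
(* The remaining case has r = d + 1 = e and f linear. Then f supplies the missing factors X of u and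
   Y of v, so it is a multiple of both X and Y, hence 0. *)
have [i0 lt] : i = 0%N /\ (d < e)%N by lia.
rewrite i0 in Ff; have [nX nY _] := none lt.
have [_ [[p Ep] [q Eq] _]] := Sx.
rewrite g0 !mul0r !addr0 in E1 E2.
have [c Ec] := form1_dividesX T Fu Du nX Ff (etrans (esym E1) Ep).
have [b Eb] := form1_dividesX TY (Fr _ _ Fv).1 Dv nY (Fr _ _ Ff).1 (etrans (esym E2) Eq).
have [_ iXY _ _] := T.
have b0 : b = 0.
  by apply: (iXY b 1%N (C c)); rewrite -Ec Eb expr1 mulrC.
by case/eqP: f0; rewrite Eb b0 rmorph0 mulr0.
Qed.
End Symmetry.
End BinaryForms.

(** * From membership in T_c to a split basis *)

Section SplitBasis.
Variables (k : fieldType) (A : idomainType) (C : {rmorphism k -> A}).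
Variables (X Y Z : A) (pi : {rmorphism A -> A}).
Hypotheses (T : triad C X Y Z) (piC : forall c, pi (C c) = C c).
Hypotheses (piX : pi X = Y) (piY : pi Y = Z) (piZ : pi Z = X).

(** Write q = p^e. At Jq the gap is at least q, and each step costs at most 3. The relevant
    exponent, a if a >= Jq and a + 1 otherwise, is at most {q/3} - 1 steps away; since 3{q/3} <= q +
    1, a gap of at least 2 remains. *)
Lemma split_basis_near p e J a : p \in [pchar k] -> odd J ->
  (J * p ^ e <= a + near3 (p ^ e))%N -> (a < J * p ^ e + near3 (p ^ e))%N ->
  split_basis X Y Z a.
Proof.
move=> hp oJ lo hi; have [d dJ] := short_syz_odd T oJ.
have hpA : p \in [pchar A] by rewrite (fmorph_pchar C).
move=> /(short_syz_Frobenius e hpA) sh.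
have q3 : (3 * near3 (p ^ e) <= p ^ e + 1)%N by rewrite /near3; lia.
move: (p ^ e)%N lo hi sh q3 => q lo hi sh q3.
have dJq : (2 * (q * d) + q <= 3 * (J * q))%N by nia.
case: (leqP (J * q) a) => Ja.
  apply: (@split_basis_short _ _ C X Y Z pi T piC piX piY piZ a
            (3 * (a - J * q) + q * d)%N).
  left; split; last by lia.
  by have := short_syz_up T (a - J * q) sh; rewrite subnKC.
apply: (@split_basis_short _ _ C X Y Z pi T piC piX piY piZ a (q * d)%N).
by right; split; [exact: short_syz_down sh | lia].
Qed.

Lemma split_basis_inT c a : has_char k c -> inT c a -> split_basis X Y Z a.
Proof.
rewrite /has_char /inT; case: eqP => // _ hc.
case: eqP hc => [-> hc a0|_ hc [cp oc [J [e [oJ e0 [lo hi]]]]]].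
  (* In characteristic 2, the even number among a and a + 1 is Jq with J odd and q >= 2, so a is Jq
     or Jq - 1. *)
  have [b [b0 ob ab]] : exists b, [/\ (0 < b)%N, ~~ odd b & b = a \/ b = a.+1].
    case: (boolP (odd a)) => oa; first by exists a.+1; split=> //=; [rewrite oa|right].
    by exists a; split=> //; left.
  have [J nJ Eb] := @pfactor_coprime 2 b isT b0.
  move: (logn 2 b) Eb => e Eb.
  have e0 : (0 < e)%N.
    by case: e Eb => // Eb; move: ob; rewrite Eb expn0 muln1 -coprime2n nJ.
  have q2 : (1 < 2 ^ e)%N by rewrite -{1}(expn0 2) ltn_exp2l.
  have n3 : (0 < near3 (2 ^ e))%N by rewrite /near3; lia.
  apply: (@split_basis_near 2 e J a hc); first by rewrite -coprime2n.
  - by lia.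
  - by lia.
case: J oJ lo hi => J oJ lo hi.
  by apply: (@split_basis_near c e J a hc) => //; lia.
(* For negative J the interval ends at or below 0 and contains no natural number. *)
have mq : (near3 (c ^ e) <= c ^ e)%N.
  by rewrite /near3; move: (c ^ e)%N => q; lia.
rewrite NegzE in lo hi; move: (near3 _) lo hi mq => m.
by move: (c ^ e)%N => q lo hi mq; nia.
Qed.

End SplitBasis.

(** * The case of k[X, Y] *)

Section BinaryPolynomials.
Variable k : fieldType.
Notation B := {mpoly k[2]}.
Let X : B := 'X_0.
Let Y : B := 'X_1.
Let Z : B := - X - Y.

Lemma triad_mpoly : triad (@mpolyC 2 k) X Y Z.
Proof.
split; first by rewrite /Z; ring.
(* Each independence follows by evaluating at a zero of the first form: (0, 1), (1, 0) and (1,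
   -1). *)
- move=> c m s /(congr1 (meval (fun i => (i != 0)%:R))).
  rewrite !mevalM mevalC rmorphXn /= !mevalXU /= mul0r expr1n mulr1.
  by move=> <-.
- move=> c m s /(congr1 (meval (fun i => (i == 0)%:R))).
  rewrite !mevalM mevalC rmorphXn /= rmorphB rmorphN /= !mevalXU /= mul0r.
  rewrite subr0 => /esym/eqP; rewrite mulf_eq0 expf_eq0 oppr_eq0 oner_eq0 andbF orbF.
  by move=> /eqP.
- move=> c m s /(congr1 (meval (fun i => if i == 0 then 1 else -1))).
  rewrite !mevalM mevalC rmorphXn /= rmorphB rmorphN /= !mevalXU /=.
  by rewrite opprK addNr mul0r expr1n mulr1 => <-.
Qed.


(** The split basis has rows (X^(a+1) r1, Y^(a+1) r2, Z^(a+1) r3) and (X^a s1, Y^a s2, Z^a s3). Its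
    three minors agree, as the rows sum to 0; cancelling the column factors leaves the stated
    identities. *)
Lemma inT_cross_product c a : has_char k c -> inT c a ->
  exists r1 r2 r3 s1 s2 s3 : B,
  [/\ Y * r2 * s3 - Z * r3 * s2 = X ^+ a,
      Z * r3 * s1 - X * r1 * s3 = Y ^+ a &
      X * r1 * s2 - Y * r2 * s1 = Z ^+ a].
Proof.
move=> hc aT; pose pi : {rmorphism B -> B} := comp_mpoly [tuple Y; Z].
have piC c' : pi c'%:MP = c'%:MP by exact: comp_mpolyC.
have piX : pi X = Y by exact: comp_mpolyXU.
have piY : pi Y = Z by exact: comp_mpolyXU.
have piZ : pi Z = X by rewrite /Z rmorphB rmorphN piX piY /Z; ring.
have T := triad_mpoly.
have [u [v [w [u' [v' [w' [S S' D]]]]]]] := split_basis_inT T piC piX piY piZ hc aT.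
have D2 := det_rot S.1 S'.1; have D3 := det_rot (syz_rot S).1 (syz_rot S').1.
rewrite D2 in D3; rewrite D in D2 D3.
have [_ [[r1 E1] [r2 E2] [r3 E3]]] := S; have [_ [[s1 F1] [s2 F2] [s3 F3]]] := S'.
have X0 : X ^+ a != 0 by rewrite expf_neq0 // (triad_neq0 T).
have Y0 : Y ^+ a != 0 by rewrite expf_neq0 // (triad_neq0 (triad_rot T)).
have Z0 : Z ^+ a != 0 by rewrite expf_neq0 // (triad_neq0 (triad_rot (triad_rot T))).
exists r1, r2, r3, s1, s2, s3; split.
- apply: (mulfI (mulf_neq0 Y0 Z0)); rewrite [RHS]mulrC mulrA -D2 E2 E3 F2 F3 !exprS.
  by ring.
- apply: (mulfI (mulf_neq0 X0 Z0)); rewrite [RHS]mulrAC -D3 E1 E3 F1 F3 !exprS.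
  by ring.
- by apply: (mulfI (mulf_neq0 X0 Y0)); rewrite -D E1 E2 F1 F2 !exprS; ring.
Qed.

End BinaryPolynomials.

(** * A regular sequence in the Fermat ring *)

Section VanishVariable.
Variables (R : comNzRingType) (n : nat) (i : 'I_n).

Definition vanish_var : {mpoly R[n]} -> {mpoly R[n]} :=
  comp_mpoly [tuple (if j == i then 0 else 'X_j) | j < n].
HB.instance Definition _ := GRing.LRMorphism.on vanish_var.

Lemma vanish_varXU j : vanish_var 'X_j = if j == i then 0 else 'X_j.
Proof. by rewrite /vanish_var comp_mpolyXU -tnth_nth tnth_mktuple. Qed.

Lemma vanish_varE p : exists q, p = vanish_var p + 'X_i * q.
Proof.
have PM p1 p2 : (exists q, p1 = vanish_var p1 + 'X_i * q) ->
    (exists q, p2 = vanish_var p2 + 'X_i * q) ->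
    exists q, p1 * p2 = vanish_var (p1 * p2) + 'X_i * q.
  move=> [q1 E1] [q2 E2]; rewrite rmorphM /=.
  exists (q1 * p2 + vanish_var p1 * q2); rewrite {1}E1 mulrDl {1}E2; ring.
have P1 : exists q, 1 = vanish_var 1 + 'X_i * q.
  by exists 0; rewrite rmorph1 mulr0 addr0.
elim/mpolyind: p => [|c m p _ _ [q Eq]].
  by exists 0; rewrite rmorph0 mulr0 addr0.
have [q' Eq'] : exists q, 'X_[m] = vanish_var 'X_[m] + 'X_i * q.
  rewrite mpolyXE_id; apply: (big_ind (fun p => exists q, p = vanish_var p + 'X_i * q)) => // j _.
  elim: (m j) => [|l IH]; rewrite ?expr0 ?exprS //; apply: PM => //.
  rewrite vanish_varXU; case: eqP => [->|_]; first by exists 1; rewrite mulr1 add0r.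
  by exists 0; rewrite mulr0 addr0.
exists (c *: q' + q); rewrite [vanish_var _]comp_mpolyD [_ \mPo _]comp_mpolyZ -!/(vanish_var _).
by rewrite {1}Eq {1}Eq' scalerDr -!mul_mpolyC; ring.
Qed.
End VanishVariable.

Lemma mpolyXU_neq0 (R : nzRingType) n (i : 'I_n) : 'X_i != 0 :> {mpoly R[n]}.
Proof. by rewrite -msupp_eq0 msuppX. Qed.

Section FermatRing.
Variables (k : fieldType) (n : nat) (hn : (0 < n)%N).
Notation x := (vx k).
Notation y := (vy k).
Notation z := (vz k).
Notation f := (fermat k n).
Notation R := (Rkn k n hn).
Notation pR := (piR k n hn).
HB.instance Definition _ := GRing.RMorphism.copy (piR k n hn) (\pi_(Rkn k n hn)).

Lemma piR_eq0 p : pR p = 0 <-> exists q, p = q * f.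
Proof.
rewrite /piR -(rmorph0 \pi_(Rkn k n hn)); split.
  move=> /eqP; rewrite piE Quotient.equivE subr0 => /pboolP[c ->].
  by exists (c ord0); rewrite big_ord1.
move=> [q ->]; apply/eqP; rewrite piE Quotient.equivE subr0; apply/pboolP.
by exists (fun=> q); rewrite big_ord1.
Qed.

Lemma piR_surj (b : R) : exists p, b = pR p.
Proof. by exists (repr b); rewrite /piR reprK. Qed.

Lemma fermat_modx : vanish_var (0 : 'I_3) f = y ^+ n + z ^+ n.
Proof.
rewrite /fermat !rmorphD !rmorphXn /= !vanish_varXU /=.
by rewrite expr0n gtn_eqF // add0r.
Qed.

(** Setting x = 0 in x p = q f gives q(0, y, z) (y^n + z^n) = 0, so x divides q and cancels. *)
Lemma piR_x_reg (b : R) : pR x * b = 0 -> b = 0.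
Proof.
have [p ->] := piR_surj b; rewrite -rmorphM => /piR_eq0[q E].
have yz0 : y ^+ n + z ^+ n != 0.
  apply/eqP => /(congr1 (meval (fun i => (i == 1)%:R))).
  rewrite mevalD !rmorphXn /= !mevalXU /= meval0 expr1n expr0n gtn_eqF //.
  by rewrite addr0 => /eqP; rewrite oner_eq0.
have q0 : vanish_var (0 : 'I_3) q = 0.
  apply: (mulIf yz0); rewrite -fermat_modx -rmorphM -E rmorphM /= vanish_varXU eqxx.
  by rewrite !mul0r.
have [q' Eq'] := vanish_varE (0 : 'I_3) q.
apply/piR_eq0; exists q'; apply: (@mulfI _ x); first exact: mpolyXU_neq0.
by rewrite E Eq' q0 add0r mulrA.
Qed.

Local Notation ex := (@vanish_var k 3 0).
Local Notation ey := (@vanish_var k 3 1).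

Lemma piR_xy_reg (b c : R) : pR y * b = pR x * c -> exists b', b = pR x * b'.
Proof.
have [p ->] := piR_surj b; have [p' ->] := piR_surj c.
move=> /eqP; rewrite -subr_eq0 -!rmorphM -rmorphB => /eqP/piR_eq0[q E].
have y0 : y != 0 by exact: mpolyXU_neq0.
have z0 : z ^+ n != 0 by rewrite expf_neq0 //; exact: mpolyXU_neq0.
have Ex : y * ex p = (y ^+ n + z ^+ n) * ex q.
  have := congr1 ex E; rewrite !(rmorphB, rmorphM) /= fermat_modx.
  by rewrite !vanish_varXU /= mul0r subr0 mulrC => ->; rewrite mulrC.
have q0 : ey (ex q) = 0.
  apply: (mulfI z0); have := congr1 ey Ex.
  rewrite !(rmorphM, rmorphD, rmorphXn) /= !vanish_varXU /= mul0r.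
  by rewrite expr0n gtn_eqF // add0r mulr0 => <-.
have [q1] := vanish_varE (1 : 'I_3) (ex q); rewrite q0 add0r => Eq1.
have [p1 Ep1] := vanish_varE (0 : 'I_3) p.
have {}Ex : ex p = (y ^+ n + z ^+ n) * q1.
  by apply: (mulfI y0); rewrite Ex Eq1 mulrCA.
(* Modulo x, p is (y^n + z^n) q1, which equals - x^n q1 in R; as n > 0 this is a multiple of x. *)
exists (pR (p1 - x ^+ n.-1 * q1)); rewrite -rmorphM.
apply/eqP; rewrite -subr_eq0 -rmorphB; apply/eqP/piR_eq0; exists q1.
have En : x ^+ n = x * x ^+ n.-1 by rewrite -exprS prednK.
by rewrite Ep1 -/x Ex /fermat En; ring.
Qed.

Lemma piR_xn_reg m (b : R) : pR x ^+ m * b = 0 -> b = 0.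
Proof.
elim: m => [|m IH]; first by rewrite mul1r.
by rewrite exprS -mulrA => /piR_x_reg.
Qed.

Lemma piR_xyn_reg l m (b c : R) : pR y ^+ l * b = pR x ^+ m * c ->
  exists b', b = pR x ^+ m * b'.
Proof.
have base l' (b0 c0 : R) : pR y ^+ l' * b0 = pR x * c0 -> exists b', b0 = pR x * b'.
  elim: l' c0 => [|l' IH] c0; first by rewrite mul1r => ->; exists c0.
  by rewrite exprS -mulrA => /piR_xy_reg[c1 /IH].
elim: m b => [|m IH] b; first by exists b; rewrite mul1r.
rewrite exprS -mulrA => E; have [b1 Eb1] := base _ _ _ E.
move: E; rewrite Eb1 mulrCA => /eqP; rewrite -subr_eq0 -mulrBr => /eqP/piR_x_reg/eqP.
rewrite subr_eq0 => /eqP/IH[b2 ->]; exists b2; by rewrite mulrA.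
Qed.
End FermatRing.

(** * Hilbert-Burch resolutions *)

Section RowCombination.
Variables (R : pzRingType) (M : lmodType R) (m : nat) (b : 'I_m -> M).

Definition row_comb (u : 'rV[R]_m) : M := \sum_i u 0 i *: b i.

Lemma row_comb_is_linear : linear row_comb.
Proof.
move=> c u v; rewrite /row_comb scaler_sumr -big_split /=; apply: eq_bigr => i _.
by rewrite !mxE scalerDl scalerA.
Qed.
HB.instance Definition _ := GRing.isLinear.Build R 'rV[R]_m M _ row_comb row_comb_is_linear.
End RowCombination.

Lemma projective_row (R : pzRingType) m : projective 'rV[R]_m.
Proof.
move=> M N g h gsurj.
have /fin_all_exists[b Eb] : forall i : 'I_m, exists t, g t = h (delta_mx 0 i).
  by move=> i; exact: gsurj.
exists (row_comb b) => p; rewrite /= {2}(row_sum_delta p) /row_comb !linear_sum.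
by apply: eq_bigr => i _; rewrite !linearZ /= Eb.
Qed.

Lemma big_ord3 (V : nmodType) (F : 'I_3 -> V) : \sum_i F i = F 0 + F 1 + F 2.
Proof.
rewrite !big_ord_recl big_ord0 addr0 addrA.
by congr (_ + F _ + F _); exact: val_inj.
Qed.

Lemma big_ord2 (V : nmodType) (F : 'I_2 -> V) : \sum_i F i = F 0 + F 1.
Proof. by rewrite !big_ord_recl big_ord0 addr0; congr (_ + F _); exact: val_inj. Qed.

Lemma ord3_ind (P : 'I_3 -> Prop) : P 0 -> P 1 -> P 2 -> forall i, P i.
Proof.
move=> P0 P1 P2 [[|[|[|//]]] lti].
- by have -> : Ordinal lti = 0 by exact: val_inj.
- by have -> : Ordinal lti = 1 by exact: val_inj.
- by have -> : Ordinal lti = 2 by exact: val_inj.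
Qed.

Lemma ord2_ind (P : 'I_2 -> Prop) : P 0 -> P 1 -> forall i, P i.
Proof.
move=> P0 P1 [[|[|//]] lti].
- by have -> : Ordinal lti = 0 by exact: val_inj.
- by have -> : Ordinal lti = 1 by exact: val_inj.
Qed.

Section HilbertBurch.
Variables (R : comNzRingType) (v1 v2 v3 w1 w2 w3 : R).
Let g1 := v2 * w3 - v3 * w2.
Let g2 := v3 * w1 - v1 * w3.
Let g3 := v1 * w2 - v2 * w1.
Hypothesis reg1 : forall b, g1 * b = 0 -> b = 0.
Hypothesis reg2 : forall b c, g2 * b = g1 * c -> exists b', b = g1 * b'.

Lemma minors_inj p q : p * v2 + q * w2 = 0 -> p * v3 + q * w3 = 0 ->
  p = 0 /\ q = 0.
Proof.
move=> E2 E3; split; apply: reg1.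
  rewrite (_ : g1 * p = (p * v2 + q * w2) * w3 - (p * v3 + q * w3) * w2).
    by rewrite E2 E3; ring.
  by rewrite /g1; ring.
rewrite (_ : g1 * q = (p * v3 + q * w3) * v2 - (p * v2 + q * w2) * v3).
  by rewrite E2 E3; ring.
by rewrite /g1; ring.
Qed.

(** Cramer's rule on the last two columns yields g1 p and g1 q. The relation makes g2 times each
    numerator a multiple of g1, so regularity permits the division. *)
Lemma minors_exact u1 u2 u3 : u1 * g1 + u2 * g2 + u3 * g3 = 0 ->
  exists p q, [/\ u1 = p * v1 + q * w1, u2 = p * v2 + q * w2 & u3 = p * v3 + q * w3].
Proof.
move=> E.
have canc a b : g1 * a = g1 * b -> a = b.
  by move=> /eqP; rewrite -subr_eq0 -mulrBr => /eqP/reg1/eqP; rewrite subr_eq0 => /eqP.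
have [p Ep] : exists p, u2 * w3 - u3 * w2 = g1 * p.
  apply: (@reg2 _ (u3 * w1 - u1 * w3)); apply/eqP; rewrite -subr_eq0.
  rewrite -(mulr0 w3) -E /g1 /g2 /g3; apply/eqP; ring.
have [q Eq] : exists q, u3 * v2 - u2 * v3 = g1 * q.
  apply: (@reg2 _ (u1 * v3 - u3 * v1)); apply/eqP; rewrite -subr_eq0.
  rewrite -(mulr0 (- v3)) -E /g1 /g2 /g3; apply/eqP; ring.
exists p, q; split; apply: canc; rewrite mulrDr !mulrA -Ep -Eq.
- by apply/eqP; rewrite -subr_eq0 -E /g1 /g2 /g3; apply/eqP; ring.
- by rewrite /g1; ring.
- by rewrite /g1; ring.
Qed.

Definition hb_rank i := match i with 0%N => 1%N | 1%N => 3 | 2 => 2 | _ => 0%N end.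

Definition hb_matrix i : 'M[R]_(hb_rank i.+1, hb_rank i) :=
  match i with
  | 0%N => \matrix_(i, j) nth 0 [:: g1; g2; g3] i
  | 1%N => \matrix_(i, j) nth 0 (if i == 0 then [:: v1; v2; v3] else [:: w1; w2; w3]) j
  | _ => 0
  end.

Lemma finite_projdim_minors (M : lmodType R) (eps : {linear 'rV[R]_1 -> M}) :
  (forall y, exists x, eps x = y) ->
  (forall x, eps x = 0 <-> exists c1 c2 c3, x 0 0 = c1 * g1 + c2 * g2 + c3 * g3) ->
  finite_projdim M.
Proof.
move=> eps_surj eps_ker.
pose P i : lmodType R := 'rV[R]_(hb_rank i).
pose d i : {linear P i.+1 -> P i} := mulmxr (hb_matrix i).
exists 2, P, d, eps; split=> //.
- by move=> i; exact: projective_row.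
- by case=> [|[|[|i]]] // _ x; exact: thinmx0.
- move=> x; rewrite eps_ker; split.
    move=> [c1 [c2 [c3 E]]].
    exists (\row_j nth 0 [:: c1; c2; c3] j); apply/rowP => j.
    by rewrite !ord1 E mxE big_ord3 !mxE.
  move=> [z <-]; exists (z 0 0), (z 0 1), (z 0 2).
  by rewrite mxE big_ord3 !mxE.
- case=> [|[|i]] x.
  + split.
      move=> /rowP/(_ 0); rewrite !mxE big_ord3 !mxE /= => /minors_exact[p [q [E1 E2 E3]]].
      exists (\row_j nth 0 [:: p; q] j); apply/rowP => j.
      by rewrite mxE big_ord2 !mxE /=; elim/ord3_ind: j.
    move=> [z <-]; apply/rowP => j; rewrite !mxE big_ord3 !mxE !big_ord2 !mxE /=.
    by rewrite /g1 /g2 /g3; ring.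
  + split.
      move=> /rowP E.
      have := E 1; have := E 2; rewrite !mxE !big_ord2 !mxE /=.
      move=> E3 E2; have [p0 q0] := minors_inj E2 E3.
      by exists 0; rewrite linear0; apply/rowP; elim/ord2_ind; rewrite mxE ?p0 ?q0.
    by move=> [z <-]; rewrite (thinmx0 z) !linear0.
  + have -> : x = 0 by exact: thinmx0.
    by split=> _; [exists 0|]; rewrite linear0.
Qed.

End HilbertBurch.

(** * The resolution of Q over the Fermat ring *)

Section Fermat.
Variables (k : fieldType) (n N : nat) (hn : (0 < n)%N) (hN : (0 < N)%N).
Notation R := (Rkn k n hn).
Notation Q := (Qkn k n N hn hN).
Notation pR := (piR k n hn).

Definition eval_Q (u : 'rV[R]_1) : Qmod k n N hn hN := \pi_Q (u 0 0).

Lemma eval_Q_is_linear : linear eval_Q.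
Proof. by move=> c u v; rewrite /eval_Q !mxE rmorphD rmorphM. Qed.
HB.instance Definition _ :=
  GRing.isLinear.Build R 'rV[R]_1 (Qmod k n N hn hN) _ eval_Q eval_Q_is_linear.

Lemma eval_Q_surj y : exists u, eval_Q u = y.
Proof. by exists (\row__ repr (y : Q)); rewrite /eval_Q mxE reprK. Qed.

Lemma eval_Q_ker u : eval_Q u = 0 <->
  exists c1 c2 c3, u 0 0 = c1 * pR (vx k ^+ N) + c2 * pR (vy k ^+ N) + c3 * pR (vz k ^+ N).
Proof.
rewrite /eval_Q -[0 in RHS](rmorph0 \pi_Q); split.
  move=> /eqP; rewrite piE Quotient.equivE subr0 => /pboolP[c ->].
  by exists (c 0), (c 1), (c 2); rewrite big_ord3.
move=> [c1 [c2 [c3 E]]]; apply/eqP; rewrite piE Quotient.equivE subr0; apply/pboolP.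
by exists (fun i => nth 0 [:: c1; c2; c3] i); rewrite big_ord3 E.
Qed.
End Fermat.

(* k a field of characteristic c; n, N positive; N = a n + r with 0 <= r <= n;
   if a \in T_c then the R_{k,n}-module Q_{k,n,N} has finite projective dimension. *)
Theorem theorem5p14 (k : fieldType) (c : nat) (hc : has_char k c)
  (n N : nat) (hn : (0 < n)%N) (hN : (0 < N)%N) (a r : nat)
  (hNar : N = (a * n + r)%N) (hrn : (r <= n)%N) (haT : inT c a) :
  finite_projdim (Qmod k n N hn hN).
Proof.
have [r1 [r2 [r3 [s1 [s2 [s3 [E1 E2 E3]]]]]]] := inT_cross_product hc haT.
pose pR := piR k n hn; pose x := pR (vx k); pose y := pR (vy k); pose z := pR (vz k).
pose phi : {rmorphism {mpoly k[2]} -> Rkn k n hn} :=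
  pR \o comp_mpoly [tuple vx k ^+ n; vy k ^+ n].
have phiX : phi 'X_0 = x ^+ n.
  by rewrite /= comp_mpolyXU /= -rmorphXn.
have phiY : phi 'X_1 = y ^+ n.
  by rewrite /= comp_mpolyXU /= -rmorphXn.
have xyz0 : x ^+ n + y ^+ n + z ^+ n = 0.
  by rewrite -!rmorphXn -!rmorphD; apply/piR_eq0; exists 1; rewrite mul1r.
have phiZ : phi (- 'X_0 - 'X_1) = z ^+ n.
  rewrite rmorphB rmorphN phiX phiY.
  by apply: (addrI (x ^+ n + y ^+ n)); rewrite xyz0; ring.
have expN t : t ^+ N = t ^+ r * (t ^+ n) ^+ a :> Rkn k n hn.
  by rewrite -exprM -exprD hNar; congr (_ ^+ _); lia.
have expn t : t ^+ n = t ^+ (n - r) * t ^+ r :> Rkn k n hn.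
  by rewrite -exprD subnK.
(* Each t^n is split as t^(n - r) t^r: the first factor stays in the column of t in the first row,
   the second goes to the other two columns of the second row. The minor omitting the column of t
   thus carries exactly t^r, besides the n-th powers needed for the substituted identity. *)
pose v t p : Rkn k n hn := t ^+ (n - r) * phi p.
pose w t t' p : Rkn k n hn := t ^+ r * t' ^+ r * phi p.
have G1 : v y r2 * w x y s3 - v z r3 * w x z s2 = x ^+ N.
  rewrite expN -phiX -[phi 'X_0 ^+ a]rmorphXn -E1 rmorphB !rmorphM phiY phiZ !expn /v /w.
  by ring.
have G2 : v z r3 * w y z s1 - v x r1 * w x y s3 = y ^+ N.
  rewrite expN -phiY -[phi 'X_1 ^+ a]rmorphXn -E2 rmorphB !rmorphM phiX phiZ !expn /v /w.
  by ring.
have G3 : v x r1 * w x z s2 - v y r2 * w y z s1 = z ^+ N.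
  rewrite expN -phiZ -[phi (- 'X_0 - 'X_1) ^+ a]rmorphXn -E3 rmorphB !rmorphM phiX phiY !expn /v /w.
  by ring.
apply: (@finite_projdim_minors _ (v x r1) (v y r2) (v z r3)
  (w y z s1) (w x z s2) (w x y s3) _ _ _ (@eval_Q k n N hn hN)).
- by move=> b; rewrite G1; exact: piR_xn_reg.
- by move=> b c'; rewrite G1 G2; exact: piR_xyn_reg.
- exact: eval_Q_surj.
- by move=> u; rewrite G1 G2 G3 -!rmorphXn; exact: eval_Q_ker.
Qed.
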